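(* Let $N\geq 1$ be a natural number and let $\mathcal{P}=\{x_0,\dots,x_{N-1}\}\subset[0,1]$ be an $N$-element point set. Let $\Gamma_N=\left\{\frac{2n+1}{2N}: n=0,1,\dots,N-1\right\}$. Then $$\mathbb P(|D_{\mathcal{P}}| < \alpha) \leq \mathbb P(|D_{\Gamma_N}|<\alpha)\qquad\text{for all } \alpha>0,$$ and equality for all $\alpha>0$ holds if and only if $\mathcal{P}=\Gamma_N$.
   Context: For an $N$-element point set $\mathcal P=\{x_0,\ldots,x_{N-1}\}\subset[0,1]$ (arranged increasingly), the one-parameter discrepancy function $D_{\mathcal P}:[0,1]\to\mathbb R$ is $$D_{\mathcal P}(t)=\sum_{n=0}^{N-1}\mathbf 1_{[0,t)}(x_n)-Nt,$$ where $\mathbf 1_A$ denotes the indicator function of the set $A$. For a measurable function $f:[0,1]\to\mathbb R$, $\mathbb P(|f|<\alpha):=|\{t\in[0,1]:|f(t)|<\alpha\}|$, where $|\cdot|$ of a set denotes Lebesgue measure. *)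

(* Defs.v *)
From HB Require Import structures.
From mathcomp Require Import all_boot all_order all_algebra finmap.
From mathcomp Require Import all_classical all_reals all_analysis.

Set Implicit Arguments.
Unset Strict Implicit.
Unset Printing Implicit Defensive.

Import Order.TTheory GRing.Theory Num.Theory.
Import numFieldNormedType.Exports.

Local Open Scope classical_set_scope.
Local Open Scope ring_scope.

(* Total on R; only its values for t in [0, 1] are used, through [prob_lt]. *)
Definition discrepancy (R : realType) (P : {fset R}) (t : R) : R :=
  \sum_(x <- P) \1_(`[0, t[) x - #|` P|%:R * t.

Definition prob_lt (R : realType) (f : R -> R) (alpha : R) : \bar R :=
  lebesgue_measure [set t : R | t \in `[0, 1] /\ `|f t| < alpha].

Definition Gamma (R : realType) (N : nat) : {fset R} :=
  [fset ((2 * n + 1)%:R / (2 * N)%:R : R) | n in iota 0 N]%fset.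

(* Main.v *)
Require Import Defs.
From HB Require Import structures.
From mathcomp Require Import all_boot all_order all_algebra finmap.
From mathcomp Require Import all_classical all_reals all_analysis.
From mathcomp Require Import measurable_realfun zify ring lra.

Set Implicit Arguments.
Unset Strict Implicit.
Unset Printing Implicit Defensive.

Import Order.TTheory GRing.Theory Num.Theory.
Import numFieldNormedType.Exports.

Local Open Scope classical_set_scope.
Local Open Scope ring_scope.

(** The inequality between the measures comes from a pointwise one. On [0, 1]
    a discrepancy function has the form k(t) - N t with k(t) a natural number,
    and for the centered regular grid this number is always an integer nearest
    to N t ([points_below_Gamma]). Hence the discrepancy of the grid is, at
    every t, the smallest in absolute value among all N-point sets
    ([discrepancy_Gamma_le]), and its sublevel sets contain those of P.

    For uniqueness the single level 1/2 suffices. Suppose some x in P is not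
    in the grid. Then N x lies strictly within 1/2 of a unique integer m, and m
    remains the only nearest integer to N t for t near x. The counting function
    of P jumps at x, so it cannot equal m on both sides of x: on a whole
    interval next to x the discrepancy of P exceeds 1/2 while that of the grid
    stays below 1/2 ([discrepancy_gt_half_interval]). That interval has
    positive length, which makes the measures of the two sublevel sets of
    level 1/2 different ([Gamma_unique]). So P is included in the grid, and the
    two have the same cardinality. *)

(** * Discrepancy as a counting function minus a linear one *)

Definition points_below (R : realType) (P : {fset R}) (t : R) : nat :=
  count (fun x => x \in `[0, t[) P.

Lemma discrepancyE (R : realType) (P : {fset R}) (t : R) :
  discrepancy P t = (points_below P t)%:R - #|` P|%:R * t.
Proof.
rewrite /discrepancy /points_below -sum1_count natr_sum [in RHS]big_mkcond /=.
congr (_ - _); apply: eq_bigr => x _.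
by rewrite indicE mem_setE; case: ifP.
Qed.

Lemma points_below_homo (R : realType) (P : {fset R}) (s t : R) :
  s <= t -> (points_below P s <= points_below P t)%N.
Proof.
move=> st; apply: sub_count => x /=.
by rewrite !in_itv /= => /andP[-> /lt_le_trans -> //].
Qed.

(** The point x itself is counted strictly after x but not at x, because the
    intervals [0, t[ are open on the right. *)
Lemma points_below_jump (R : realType) (P : {fset R}) (x t : R) :
  x \in P -> 0 <= x -> x < t -> (points_below P x < points_below P t)%N.
Proof.
move=> xP x0 xt; have xt_in : x \in `[0, t[ by rewrite in_itv /= x0.
have x_out : (x \in `[0, x[) = false by rewrite in_itv /= ltxx andbF.
rewrite /points_below !(permP (perm_to_rem xP)) /= xt_in x_out ltnS.
apply: sub_count => y /=; rewrite !in_itv /= => /andP[-> /=].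
by move=> /lt_trans; apply.
Qed.

Lemma points_below_mem (R : realType) (P : {fset R}) (x : R) :
  x \in P -> (points_below P x < #|` P|)%N.
Proof.
move=> xP; rewrite /points_below ltn_neqAle count_size andbT -all_count.
by apply/negP => /allP /(_ _ xP); rewrite in_itv /= ltxx andbF.
Qed.

(** A difference of two monotone functions is measurable. *)
Lemma measurable_discrepancy (R : realType) (P : {fset R}) :
  measurable_fun [set: R] (discrepancy P).
Proof.
rewrite (_ : discrepancy P = (fun t => (points_below P t)%:R) \-
   (fun t => #|` P|%:R * t)); last by apply/funext => t; exact: discrepancyE.
apply: measurable_funB; last exact: measurable_funM.
apply: nondecreasing_measurable => // s t st.
by rewrite ler_nat points_below_homo.
Qed.

Lemma measurable_sublevel (R : realType) (P : {fset R}) (a : R) :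
  measurable [set t : R | t \in `[0, 1] /\ `|discrepancy P t| < a].
Proof.
rewrite (_ : mkset _ = `[0, 1] `&` (Num.norm \o discrepancy P) @^-1` `]-oo, a[).
  have mf : measurable_fun [set: R] (Num.norm \o discrepancy P).
    by apply: measurableT_comp => //; exact: measurable_discrepancy.
  by apply: measurableI => //; rewrite -[X in measurable X]setTI; exact: mf.
by apply/seteqP; split => t /=; rewrite in_itv.
Qed.

(** * Nearest integers *)

Lemma nat_nearest_gt (R : realType) (m k : nat) (y : R) :
  k != m -> `|m%:R - y| < 1 / 2 -> 1 / 2 < `|k%:R - y|.
Proof.
rewrite ltr_norml lter_normr neq_ltn => /orP[].
- by rewrite -(ler_nat R) -natr1 => km ?; apply/orP; right; lra.
- by rewrite -(ler_nat R) -natr1 => mk ?; apply/orP; left; lra.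
Qed.

Lemma nat_nearest_le (R : realType) (m k : nat) (y : R) :
  `|m%:R - y| <= 1 / 2 -> `|m%:R - y| <= `|k%:R - y|.
Proof.
have [-> //|km my] := eqVneq k m; apply: (le_trans my); move: my km.
rewrite ler_norml lter_normr neq_ltn => my /orP[].
- by rewrite -(ler_nat R) -natr1 => km; apply/orP; right; lra.
- by rewrite -(ler_nat R) -natr1 => mk; apply/orP; left; lra.
Qed.

(** Ties are broken downwards, to match the left-continuity of the counting
    function of a point set. *)
Lemma nearest_nat (R : realType) (y : R) : 0 <= y ->
  exists m : nat, m%:R - 1 / 2 < y <= m%:R + 1 / 2.
Proof.
move=> y0; have /andP[c1 c2] := ceil_itv (y - 1 / 2).
(* The ceiling is nonnegative: it is an integer greater than -1. *)
have : - 1 < (Num.ceil (y - 1 / 2))%:~R :> R by lra.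
rewrite (_ : -1 = (-1)%:~R) // ltr_int.
case: (Num.ceil _) c1 c2 => [m|m] //= c1 c2 _; exists m.
rewrite intrB /= -!pmulrn in c1 c2; lra.
Qed.

(** * The centered regular grid *)

Lemma Gamma_ltE (R : realType) (N n : nat) (t : R) : (1 <= N)%N ->
  ((2 * n + 1)%:R / (2 * N)%:R < t) = (n%:R + 1 / 2 < N%:R * t).
Proof.
move=> N1; rewrite ltr_pdivrMr ?ltr0n ?muln_gt0 // natrD !natrM.
by apply/idP/idP => H; lra.
Qed.

Lemma Gamma_inj (R : realType) (N : nat) : (1 <= N)%N ->
  injective (fun n => (2 * n + 1)%:R / (2 * N)%:R : R).
Proof.
move=> N1 m n /mulIf H; have /H/eqP : ((2 * N)%:R : R)^-1 != 0.
  by rewrite invr_eq0 pnatr_eq0; lia.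
by rewrite eqr_nat; lia.
Qed.

Lemma Gamma_enum (R : realType) (N : nat) : (1 <= N)%N ->
  perm_eq (Gamma R N) [seq (2 * n + 1)%:R / (2 * N)%:R | n <- iota 0 N].
Proof.
move=> N1; have Ginj := Gamma_inj (R := R) N1.
apply: (perm_trans (enum_imfset _ (in2W Ginj))); apply/perm_map/uniq_perm.
- exact: enum_finmem_uniq.
- exact: iota_uniq.
- exact: enum_finmemE.
Qed.

Lemma card_Gamma (R : realType) (N : nat) : (1 <= N)%N ->
  #|` Gamma R N| = N.
Proof. by move=> /(Gamma_enum R)/perm_size ->; rewrite size_map size_iota. Qed.

(** After scaling by N the grid points become the n + 1/2, and those strictly
    below N t are exactly the ones with n < m; there are m of them because
    t <= 1 forces m <= N. *)
Lemma points_below_Gamma (R : realType) (N m : nat) (t : R) : (1 <= N)%N ->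
  t \in `[0, 1] -> m%:R - 1 / 2 < N%:R * t <= m%:R + 1 / 2 ->
  points_below (Gamma R N) t = m.
Proof.
move=> N1; rewrite in_itv /= => /andP[t0 t1] /andP[mt tm].
have mN : (m <= N)%N.
  have Nt : N%:R * t <= N%:R by rewrite ler_piMr.
  rewrite leqNgt; apply/negP; rewrite -(ler_nat R) -natr1 => ?; lra.
rewrite /points_below (permP (Gamma_enum R N1)) count_map.
have E : {in iota 0 N, preim (fun n => (2 * n + 1)%:R / (2 * N)%:R)
    (fun x => x \in `[0, t[) =1 (fun n => n < m)%N}.
  move=> n _ /=; rewrite in_itv /= divr_ge0 //= Gamma_ltE //.
  have [nm|mn] := ltnP n m.
    by move: nm; rewrite -(ler_nat R) -natr1 => nm; apply/idP; lra.
  by move: mn; rewrite -(ler_nat R) => mn; apply/negbTE; rewrite -leNgt; lra.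
by rewrite (eq_in_count E) -size_filter (@filter_iota_ltn 0) // size_iota.
Qed.

(** The competitor P also contributes a natural number minus N t, and no natural
    number is closer to N t than the one counting the grid points below t. *)
Lemma discrepancy_Gamma_le (R : realType) (N : nat) (P : {fset R}) (t : R) :
  (1 <= N)%N -> #|` P| = N -> t \in `[0, 1] ->
  `|discrepancy (Gamma R N) t| <= `|discrepancy P t|.
Proof.
move=> N1 cardP t01.
have Nt0 : 0 <= N%:R * t.
  by move: t01; rewrite in_itv => /andP[? _]; rewrite mulr_ge0.
have [m /[dup] Hm /andP[m1 m2]] := nearest_nat Nt0.
rewrite !discrepancyE cardP card_Gamma // (points_below_Gamma _ _ Hm) //.
by apply: nat_nearest_le; rewrite ler_norml; lra.
Qed.

Lemma Gamma_mem (R : realType) (N n : nat) (x : R) : (1 <= N)%N ->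
  (n < N)%N -> N%:R * x = n%:R + 1 / 2 -> x \in Gamma R N.
Proof.
move=> N1 nN xE; apply/imfsetP; exists n => /=; first by rewrite mem_iota.
have N0 : N%:R != 0 :> R by rewrite pnatr_eq0 -lt0n.
apply: (mulfI N0); rewrite xE natrD !natrM invfM mulrCA mulrA.
by field.
Qed.

(** * A point off the grid creates a gap *)

(** With m the integer nearest to N x, the upward jump at x of the counting
    function k of P gives two cases. If k(x) >= m, then k > m to the right of x,
    and the interval extends up to (m + 1/2) / N, where m stops being nearest.
    If k(x) < m, then k < m to the left of x as well, and the interval starts
    at (m - 1/2) / N. *)
Lemma discrepancy_gt_half_interval (R : realType) (N : nat) (P : {fset R})
    (x : R) :
  (1 <= N)%N -> #|` P| = N -> x \in P -> x \in `[0, 1] -> x \notin Gamma R N ->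
  exists a b : R, [/\ a < b, `]a, b[ `<=` `[0, 1]%classic &
    {in `]a, b[, forall t, `|discrepancy (Gamma R N) t| < 1 / 2 /\
                           1 / 2 < `|discrepancy P t|}].
Proof.
move=> N1 cardP xP; rewrite in_itv /= => /andP[x0 x1] xG.
have N0 : 0 < N%:R :> R by rewrite ltr0n.
have [m /andP[mx xm]] := nearest_nat (mulr_ge0 (ltW N0) x0).
(* Equality would put x on the grid, or beyond 1 when m >= N. *)
have {}xm : N%:R * x < m%:R + 1 / 2.
  have [mN|Nm] := ltnP m N.
    rewrite lt_neqAle xm andbT; apply/eqP => xE.
    by move: xG; rewrite (Gamma_mem N1 mN xE).
  have Nx : N%:R * x <= N%:R by rewrite ler_piMr // ltW.
  by move: Nm; rewrite -(ler_nat R); lra.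
(* Where m is the only nearest integer, the grid counts m points, so any other
   count for P is more than 1/2 away. *)
have near_m t : t \in `[0, 1] -> m%:R - 1 / 2 < N%:R * t < m%:R + 1 / 2 ->
    points_below P t != m ->
    `|discrepancy (Gamma R N) t| < 1 / 2 /\ 1 / 2 < `|discrepancy P t|.
  move=> t01 /andP[mt tm] ktm.
  rewrite !discrepancyE cardP card_Gamma // (@points_below_Gamma _ _ m) //;
    last by rewrite mt ltW.
  split; first by rewrite ltr_norml; lra.
  by apply: nat_nearest_gt ktm _; rewrite ltr_norml; lra.
have [mk|km] := leqP m (points_below P x).
(* As x is not below itself, m <= k(x) <= N - 1; hence the interval on the right
   of x stays in [0, 1]. *)
- have mN : m%:R + 1 <= N%:R :> R.
    by rewrite natr1 ler_nat -cardP (leq_ltn_trans mk (points_below_mem xP)).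
  exists x, ((m%:R + 1 / 2) / N%:R); split.
  + by rewrite ltr_pdivlMr // mulrC.
  + move=> t /=; rewrite !in_itv /= => /andP[xt]; rewrite ltr_pdivlMr // => tN.
    apply/andP; split; first by lra.
    by rewrite -(ler_pM2r N0); lra.
  + move=> t; rewrite in_itv /= => /andP[xt]; rewrite ltr_pdivlMr // => tN.
    have Nxt : N%:R * x < N%:R * t by rewrite ltr_pM2l.
    apply: near_m.
    * rewrite in_itv /= -[t <= 1](ler_pM2r N0); lra.
    * lra.
    * by rewrite gtn_eqF // (leq_ltn_trans mk (points_below_jump xP x0 xt)).
- have m1 : 1 <= m%:R :> R by rewrite ler1n (leq_ltn_trans _ km).
  exists ((m%:R - 1 / 2) / N%:R), x; split.
  + by rewrite ltr_pdivrMr // [x * _]mulrC.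
  + move=> t /=; rewrite !in_itv /= => /andP[]; rewrite ltr_pdivrMr // => tN xt.
    apply/andP; split; last by lra.
    by rewrite -(pmulr_lge0 _ N0); lra.
  + move=> t; rewrite in_itv /= => /andP[]; rewrite ltr_pdivrMr // => tN tx.
    have Nxt : N%:R * t < N%:R * x by rewrite ltr_pM2l.
    apply: near_m.
    * rewrite in_itv /= -(pmulr_lge0 t N0); lra.
    * lra.
    * by rewrite ltn_eqF // (leq_ltn_trans (points_below_homo P (ltW tx)) km).
Qed.

(** The sublevel set of the grid contains that of P together with a disjoint
    interval of positive length; since the measures are finite they cannot
    agree. *)
Lemma Gamma_unique (R : realType) (N : nat) (P : {fset R}) :
  (1 <= N)%N -> {in P, forall x : R, x \in `[0, 1]} -> #|` P| = N ->
  prob_lt (discrepancy P) (1 / 2) = prob_lt (discrepancy (Gamma R N)) (1 / 2) ->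
  P = Gamma R N.
Proof.
move=> N1 P01 cardP; rewrite /prob_lt.
set A := [set t | _ /\ `|discrepancy P t| < _].
set B := [set t | _ /\ _] => AB.
apply/eqP; rewrite eqEfcard cardP card_Gamma // leqnn andbT.
apply/fsubsetP => x xP; apply: contraT => xG.
have [a [b [ab J01 J]]] :=
  discrepancy_gt_half_interval N1 cardP xP (P01 _ xP) xG.
have mA : measurable A by exact: measurable_sublevel.
have mB : measurable B by exact: measurable_sublevel.
have mJ : measurable (`]a, b[ : set R) by [].
have AJ0 : A `&` `]a, b[ = set0.
  rewrite -subset0 => t [[_ tA] tJ].
  by have [_ /lt_trans/(_ tA)] := J t tJ; rewrite ltxx.
have AJB : A `|` `]a, b[ `<=` B.
  move=> t [[t01 tA]|tJ]; split => //.
  - exact: le_lt_trans (discrepancy_Gamma_le N1 cardP t01) tA.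
  - exact: J01.
  - exact: (J t tJ).1.
have A_fin : lebesgue_measure A \is a fin_num.
  rewrite ge0_fin_numE //.
  apply: (@le_lt_trans _ _ (lebesgue_measure (`[0, 1] : set R))).
    by apply: le_measure; rewrite ?inE // => t [].
  by rewrite lebesgue_measure_itv /= lte_fin ltr01 -EFinD ltry.
have J_gt0 : (0 < lebesgue_measure (`]a, b[%classic : set R))%E.
  by rewrite lebesgue_measure_itv /= lte_fin ab -EFinD lte_fin subr_gt0.
have : (lebesgue_measure (A `|` `]a, b[) <= lebesgue_measure B)%E.
  by apply: le_measure; rewrite ?inE //; exact: measurableU.
rewrite measureU // -AB -[leRHS]adde0 leeD2lE //.
by move=> /(lt_le_trans J_gt0); rewrite ltxx.
Qed.

Theorem theorem2p1 (R : realType) (N : nat) (hN : (1 <= N)%N) (P : {fset R})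
    (P01 : {in P, forall x : R, x \in `[0, 1]}) (cardP : #|` P| = N) :
  (forall alpha : R, 0 < alpha ->
     (prob_lt (discrepancy P) alpha
      <= prob_lt (discrepancy (Gamma R N)) alpha)%E)
  /\ ((forall alpha : R, 0 < alpha ->
         prob_lt (discrepancy P) alpha
         = prob_lt (discrepancy (Gamma R N)) alpha)
      <-> P = Gamma R N).
Proof.
split=> [a a0|]; last split=> [eqPG|-> //].
  apply: le_measure; rewrite ?inE; try exact: measurable_sublevel.
  move=> t [t01 tP]; split => //.
  exact: le_lt_trans (discrepancy_Gamma_le hN cardP t01) tP.
by apply: Gamma_unique => //; apply: eqPG; rewrite divr_gt0.
Qed.
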